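(* Let $\sigma$ be as in the context, with the exponent $\alpha$ of condition $(\Sigma 3)$ satisfying $\alpha>1$, and assume in addition that $M_1(\phi_\sigma')<+\infty$. Let $f\in C(I)$ be such that $$\|F_n(f,\cdot)-f(\cdot)\|_\infty=\mathcal O(n^{-\nu}),\qquad n\to+\infty,$$ for some $0<\nu<1$. Then $f\in Lip(\nu)$.
   Context: $\sigma:\mathbb R\to\mathbb R$ is a non-decreasing sigmoidal function ($\lim_{x\to-\infty}\sigma(x)=0$, $\lim_{x\to+\infty}\sigma(x)=1$) satisfying: $(\Sigma1)$ $\sigma(x)-1/2$ is an odd function; $(\Sigma2)$ $\sigma\in C^2(\mathbb R)$ and $\sigma$ is concave on $[0,+\infty)$; $(\Sigma3)$ $\sigma(x)=\mathcal O(|x|^{-1-\alpha})$ as $x\to-\infty$, for some $\alpha>0$. Set $\phi_\sigma(x):=\frac12[\sigma(x+1)-\sigma(x-1)]$, $x\in\mathbb R$, and $\Psi_\sigma(\mathbf x):=\prod_{i=1}^d\phi_\sigma(x_i)$ for $\mathbf x=(x_1,\dots,x_d)\in\mathbb R^d$. For a function $g:\mathbb R\to\mathbb R$ and $\beta\ge0$, $M_\beta(g):=\sup_{x\in\mathbb R}\sum_{k\in\mathbb Z}|g(x-k)|\,|k-x|^\beta$. Let $I=\prod_{i=1}^d[a_i,b_i]$ with $a_i<b_i$ real; $C(I)$ is the space of continuous real functions on $I$ with the sup-norm $\|\cdot\|_\infty$. Let $\mathcal J_n:=\{\mathbf k\in\mathbb Z^d:\lceil na_i\rceil\le k_i\le\lfloor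 nb_i\rfloor,\ i=1,\dots,d\}$. For $f:I\to\mathbb R$ bounded and $n\in\mathbb N^+$, the neural network operators are $$F_n(f,\mathbf x):=\frac{\sum_{\mathbf k\in\mathcal J_n}f(\mathbf k/n)\Psi_\sigma(n\mathbf x-\mathbf k)}{\sum_{\mathbf k\in\mathcal J_n}\Psi_\sigma(n\mathbf x-\mathbf k)},\qquad \mathbf x\in I.$$ The modulus of continuity is $\omega(f,\delta):=\sup\{|f(\mathbf x)-f(\mathbf y)|:\mathbf x,\mathbf y\in I,\ \|\mathbf x-\mathbf y\|_2\le\delta\}$, $\delta>0$, and for $0<\nu\le1$, $Lip(\nu):=\{f\in C(I):\omega(f,\delta)=\mathcal O(\delta^\nu)\text{ as }\delta\to0^+\}$. *)

(* Defs.v *)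
From HB Require Import structures.
From mathcomp Require Import all_boot all_order all_algebra.
From mathcomp Require Import all_classical all_reals all_analysis.
Set Implicit Arguments. Unset Strict Implicit. Unset Printing Implicit Defensive.
Import Order.TTheory GRing.Theory Num.Theory numFieldNormedType.Exports.
Local Open Scope classical_set_scope.
Local Open Scope ring_scope.

Section Defs.
Variable R : realType.

Definition sigmoidal (sigma : R -> R) : Prop :=
  {homo sigma : x y / x <= y} /\
  sigma x @[x --> -oo] --> (0 : R) /\
  sigma x @[x --> +oo] --> (1 : R).

Definition Sigma1 (sigma : R -> R) : Prop :=
  forall x, sigma (- x) - 2^-1 = - (sigma x - 2^-1).

Definition Sigma2 (sigma : R -> R) : Prop :=
  (forall x, derivable sigma x 1) /\
  (forall x, derivable (derive1 sigma) x 1) /\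
  continuous (derive1 (derive1 sigma)) /\
  (forall x y t, 0 <= x -> 0 <= y -> 0 <= t <= 1 ->
     t * sigma x + (1 - t) * sigma y <= sigma (t * x + (1 - t) * y)).

Definition Sigma3 (sigma : R -> R) (alpha : R) : Prop :=
  0 < alpha /\
  exists C : R, exists x0 : R,
    forall x, x <= x0 -> `|sigma x| <= C * powR `|x| (- 1 - alpha).

Definition phi_sigma (sigma : R -> R) (x : R) : R :=
  2^-1 * (sigma (x + 1) - sigma (x - 1)).

Definition Psi_sigma (sigma : R -> R) (d : nat) (v : 'I_d -> R) : R :=
  \prod_(i < d) phi_sigma sigma (v i).

Definition M_beta (beta : R) (g : R -> R) : \bar R :=
  ereal_sup (range (fun x : R =>
    (\esum_(k in [set: int]) (`|g (x - k%:~R)| * powR `|k%:~R - x| beta)%:E)%E)).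

Definition box (d : nat) (a b : 'I_d -> R) : set 'rV[R]_d :=
  [set x | forall i, a i <= x ord0 i <= b i].

Definition Jn (d : nat) (a b : 'I_d -> R) (n : nat) : set {ffun 'I_d -> int} :=
  [set k | forall i, Num.ceil (n%:R * a i) <= k i <= Num.floor (n%:R * b i)].

Definition Fn (sigma : R -> R) (d : nat) (a b : 'I_d -> R)
    (f : 'rV[R]_d -> R) (n : nat) (x : 'rV[R]_d) : R :=
  (\sum_(k \in Jn a b n)
      f (\row_i ((k i)%:~R / n%:R)) *
      Psi_sigma sigma (fun i => n%:R * x ord0 i - (k i)%:~R))
  / (\sum_(k \in Jn a b n)
      Psi_sigma sigma (fun i => n%:R * x ord0 i - (k i)%:~R)).

Definition norm2 (d : nat) (v : 'rV[R]_d) : R :=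
  Num.sqrt (\sum_(i < d) (v ord0 i) ^+ 2).

Definition modcont (d : nat) (I : set 'rV[R]_d) (f : 'rV[R]_d -> R) (delta : R)
    : \bar R :=
  ereal_sup [set r | exists x y, I x /\ I y /\ norm2 (x - y) <= delta /\
                                 r = (`|f x - f y|)%:E].

Definition CI (d : nat) (I : set 'rV[R]_d) (f : 'rV[R]_d -> R) : Prop :=
  {within I, continuous f}.

Definition Lip (d : nat) (I : set 'rV[R]_d) (nu : R) (f : 'rV[R]_d -> R) : Prop :=
  CI I f /\
  exists C : R, exists delta0 : R, 0 < delta0 /\
    forall delta, 0 < delta < delta0 ->
      (modcont I f delta <= (C * powR delta nu)%:E)%E.

End Defs.

(* Main.v *)
(** [F_n f] has Lipschitz constant [O(n * omega(f, 1/n))]: its derivative in one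
coordinate is a sum of [f(k/n) * dw_k] with [sum_k dw_k = 0], so [f(k/n)] may be
replaced by [f(k/n) - f(x)], which is at most [omega(f, 1/n)] times a product of
factors [1 + |n x_i - k_i|]; the sum then factors into one-dimensional moments,
bounded uniformly through [M_1(phi')] and the decay of [phi].  Approximating [f]
by [F_n f] gives [omega(f, delta) <= 2 C n^-nu + K n delta omega(f, 1/n)].
Along [n = N A^j], [delta = 1/(A n)], with [A] so large that
[K / A <= A^-nu / 2] (possible since [nu < 1]), this recursion yields
[omega(f, 1/n) = O(n^-nu)]. *)
Require Import Defs.
From HB Require Import structures.
From mathcomp Require Import all_boot all_order all_algebra.
From mathcomp Require Import all_classical all_reals all_analysis.
From mathcomp Require Import zify ring lra.
Import Order.TTheory GRing.Theory Num.Theory numFieldNormedType.Exports.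
Local Open Scope classical_set_scope.
Local Open Scope ring_scope.

Set Implicit Arguments.
Unset Strict Implicit.

(** * The kernel phi_sigma *)

(** Summation by parts with step two, matching the gap of two between the arguments of [sigma] in
    [phi_sigma]. The bracket on the left is the boundary term; it is dropped later because [tau] is
    non-negative there. *)
Lemma sum_abel_double (R : realType) (tau : nat -> R) (M : nat) :
  \sum_(0 <= m < M) m.+2%:R * (tau m - tau m.+2)
    + (M.+1%:R * tau M + M.+2%:R * tau M.+1)
  = tau 0%N + 2 * tau 1%N + \sum_(0 <= m < M) (tau m + tau m.+2).
Proof.
elim: M => [|M IH]; first by rewrite !big_geq//; ring.
rewrite big_nat_recr//= [in RHS]big_nat_recr//= [in RHS]addrA -IH -!natr1; ring.
Qed.

Lemma sum_pronic_le1 (R : realType) (M : nat) :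
  \sum_(0 <= m < M) (m.+1%:R * m.+2%:R)^-1 <= 1 :> R.
Proof.
suff -> : \sum_(0 <= m < M) (m.+1%:R * m.+2%:R)^-1 = 1 - M.+1%:R^-1 :> R.
  by rewrite gerBl invr_ge0.
elim: M => [|M IH]; first by rewrite big_geq// invr1 subrr.
rewrite big_nat_recr//= IH -!natr1; field.
have M0 : 0 <= M%:R :> R by [].
by apply/andP; split; apply: lt0r_neq0; lra.
Qed.

(* Abel summation trades the weight [m + 2] for an unweighted sum of [tau]; with
[tau] a tail of [1 - sigma], this bounds the first moment of [phi_sigma]. *)
Lemma sum_second_diff_le (R : realType) (tau : nat -> R) (C : R) (M : nat) :
  (forall m, 0 <= tau m <= C * (m.+1%:R * m.+2%:R)^-1) ->
  \sum_(0 <= m < M) m.+2%:R * (tau m - tau m.+2) <= 4 * C.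
Proof.
move=> H.
have C0 : 0 <= C.
  have /andP[h1 h2] := H 0%N; have := le_trans h1 h2.
  by rewrite pmulr_lge0// invr_gt0.
have ntau m : 0 <= tau m by case/andP: (H m).
have S1 : \sum_(0 <= m < M) tau m <= C.
  apply: (@le_trans _ _ (\sum_(0 <= m < M) C * (m.+1%:R * m.+2%:R)^-1)).
    by apply: ler_sum => m _; case/andP: (H m).
  by rewrite -mulr_sumr ler_piMr// sum_pronic_le1.
have S2 : \sum_(0 <= m < M) tau m.+2 <= C.
  apply: (@le_trans _ _ (\sum_(0 <= m < M) C * (m.+1%:R * m.+2%:R)^-1)).
    apply: ler_sum => m _; case/andP: (H m.+2) => _ /le_trans; apply.
    rewrite ler_wpM2l// lef_pV2 ?posrE ?mulr_gt0//.
    by apply: ler_pM => //; rewrite ler_nat; lia.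
  by rewrite -mulr_sumr ler_piMr// sum_pronic_le1.
have h0 : tau 0%N <= C / 2 by case/andP: (H 0%N) => _; rewrite mul1r.
have h1 : 2 * tau 1%N <= C.
  by case/andP: (H 1%N) => _ /le_trans h; have := h _ (lexx _); lra.
have := sum_abel_double tau M; rewrite big_split/=.
have : 0 <= M.+1%:R * tau M + M.+2%:R * tau M.+1 by rewrite addr_ge0 ?mulr_ge0.
lra.
Qed.

(** Bounds uniform over duplicate-free lists stand in for sums over all integers. Any such list lies
    in a window [p - M < k <= p + M], which splits into two one-sided progressions starting at [p]
    and [p + 1]. *)
Lemma sum_int_le_two_sided (R : realType) (F : int -> R) (p : int) (A B : R)
    (r : seq int) :
  (forall k, 0 <= F k) ->
  (forall M, \sum_(0 <= m < M) F (p - m%:Z) <= A) ->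
  (forall M, \sum_(0 <= m < M) F (p + 1 + m%:Z) <= B) ->
  uniq r -> \sum_(k <- r) F k <= A + B.
Proof.
move=> F0 hA hB ur.
have [M hM] : exists M, forall k, k \in r -> (`|p - k| < M)%N.
  exists (\sum_(k <- r) `|p - k|)%N.+1 => k kr.
  by rewrite ltnS (big_rem k)//= leq_addr.
pose s := [seq p - m%:Z | m <- iota 0 M] ++ [seq p + 1 + m%:Z | m <- iota 0 M].
have us : uniq s.
  rewrite cat_uniq !map_inj_uniq ?iota_uniq//=; try by move=> x y; lia.
  rewrite andbT; apply/hasPn => _ /mapP[m _ ->]; apply/mapP => -[m' _]; lia.
have rs : {subset r <= s}.
  move=> k kr; have hk := hM _ kr.
  rewrite mem_cat; have [kp|kp] := lerP k p; apply/orP; [left|right].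
    by apply/mapP; exists `|p - k|%N; rewrite ?mem_iota//=; lia.
  by apply/mapP; exists `|p - k|.-1%N; rewrite ?mem_iota//=; lia.
apply: (@le_trans _ _ (\sum_(k <- s) F k)).
  have rP : perm_eq [seq k <- s | k \in r] r.
    apply: uniq_perm => //; first exact: filter_uniq.
    by move=> k; rewrite mem_filter; case: (boolP (k \in r)) => // /rs ->.
  rewrite [leRHS](bigID (mem r))/= -[X in _ <= X + _]big_filter.
  rewrite (perm_big _ rP)/=.
  by rewrite lerDl sumr_ge0.
have hAM := hA M; have hBM := hB M; rewrite /index_iota subn0 in hAM hBM.
by rewrite big_cat !big_map lerD.
Qed.

Section Phi.
Variables (R : realType) (sigma : R -> R).
Hypotheses (sg : sigmoidal sigma) (s1 : Sigma1 sigma) (s2 : Sigma2 sigma).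

Lemma sigmoidal_ge0 x : 0 <= sigma x.
Proof.
case: sg => ndec [h0 _].
apply: (cvgr_to_le h0); near=> t; apply: ndec.
by near: t; apply: nbhs_ninfty_le; rewrite num_real.
Unshelve. all: by end_near. Qed.

Lemma Sigma1E x : sigma (- x) = 1 - sigma x.
Proof. have := s1 x; lra. Qed.

Lemma phi_sigma_even x : phi_sigma sigma (- x) = phi_sigma sigma x.
Proof.
have e1 : - x + 1 = - (x - 1) by rewrite opprB addrC.
have e2 : - x - 1 = - (x + 1) by rewrite opprD.
rewrite /phi_sigma e1 e2 !Sigma1E.
by congr (_ * _); lra.
Qed.

Lemma phi_sigma_ge0 x : 0 <= phi_sigma sigma x.
Proof.
case: sg => ndec _; rewrite /phi_sigma mulr_ge0 ?invr_ge0 ?ler0n// subr_ge0.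
by apply: ndec; lra.
Qed.

(** Keeps the denominators away from zero. Concavity puts [sigma] above the chord from 0 to a point
    [X] with [sigma X > 1/2], so [sigma 1 > 1/2 = sigma 0]. For [|u| <= 1], the interval from
    [u - 1] to [u + 1] contains [0, 1] or [-1, 0], and by symmetry [sigma] grows equally on both. *)
Lemma phi_sigma_lower_bound :
  exists2 c, 0 < c & forall u, `|u| <= 1 -> c <= phi_sigma sigma u.
Proof.
case: (sg) => ndec [_ h1]; case: (s2) => _ [_ [_ conc]].
have sigma0 : sigma 0 = 2^-1 by have := s1 0; rewrite oppr0; lra.
have [X [X1 hX]] : exists X, 1 < X /\ 2^-1 < sigma X.
  near (pinfty_nbhs R) => X; exists X; split; near: X.
    exact: nbhs_pinfty_gt.
  by apply: (cvgr_gt _ h1); lra.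
have s1gt : 2^-1 < sigma 1.
  have := @conc X 0 X^-1; rewrite mulr0 addr0 mulVf ?sigma0; last first.
    by apply: lt0r_neq0; lra.
  have X0 : 0 < X^-1 by rewrite invr_gt0; lra.
  have X1' : X^-1 <= 1 by rewrite invf_le1; lra.
  move=> /(_ _ (lexx _)) h; have {h} : X^-1 * sigma X + (1 - X^-1) / 2 <= sigma 1.
    by apply: h; lra.
  suff : 0 < X^-1 * (sigma X - 2^-1) by lra.
  by rewrite mulr_gt0// subr_gt0.
exists ((sigma 1 - 2^-1) / 2); first lra.
move=> u; rewrite ler_norml => /andP[u0 u1]; rewrite /phi_sigma.
have sm1 := Sigma1E 1.
have [u_ge0|u_lt0] := lerP 0 u.
  have h : sigma 1 <= sigma (u + 1) by apply: ndec; lra.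
  have h' : sigma (u - 1) <= sigma 0 by apply: ndec; lra.
  lra.
have h : sigma 0 <= sigma (u + 1) by apply: ndec; lra.
have h' : sigma (u - 1) <= sigma (- 1) by apply: ndec; lra.
lra.
Unshelve. all: by end_near. Qed.

(** By symmetry [1 - sigma x = sigma (- x)], which is O(x^-2) because [alpha > 1]. The shifts 2 and
    3 make the weight dominate [(m + 1) * (m + 2)] at [x = v + m - 1] with [v >= 0]. *)
Lemma sigmoidal_tail alpha : Sigma3 sigma alpha -> 1 < alpha ->
  exists C, forall x, -1 <= x -> (1 - sigma x) * ((x + 2) * (x + 3)) <= C.
Proof.
case=> alpha0 [C0 [x0 hC]] alpha1; case: (sg) => ndec _.
pose X := Num.max (- x0) 1.
(* The first term serves [x > X], where [x >= 1] gives [(x + 2) * (x + 3) <= 12 * x ^+ 2]; the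
   second serves [-1 <= x <= X], where [1 - sigma x <= 1]. *)
exists (`|C0| * 12 + (X + 2) * (X + 3)) => x x_ge.
have X1 : 1 <= X by rewrite le_max lexx orbT.
have XX : 0 <= (X + 2) * (X + 3) by apply: mulr_ge0; lra.
have xx : 0 <= (x + 2) * (x + 3) by apply: mulr_ge0; lra.
have [xX|Xx] := lerP x X.
  apply: (@le_trans _ _ ((X + 2) * (X + 3))); last by rewrite lerDr mulr_ge0.
  apply: (@le_trans _ _ ((x + 2) * (x + 3))); last by apply: ler_pM; lra.
  by rewrite ler_piMl//; have := sigmoidal_ge0 x; lra.
apply: (@le_trans _ _ (`|C0| * 12)); last by rewrite lerDl.
have xx0 : - x <= x0.
  by rewrite lerNl (le_trans _ (ltW Xx))// le_max lexx.
have x1 : 1 <= x by apply: le_trans X1 (ltW Xx).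
have x0' : 0 < x by lra.
have hs : 1 - sigma x <= `|C0| * (x ^+ 2)^-1.
  rewrite -Sigma1E (le_trans (ler_norm _))// (le_trans (hC _ xx0))//.
  rewrite normrN (gtr0_norm x0').
  apply: (@le_trans _ _ (`|C0| * x `^ (-1 - alpha))).
    by rewrite ler_wpM2r ?powR_ge0 ?ler_norm.
  rewrite ler_wpM2l// -powR_mulrn ?(ltW x0')// -powRN.
  by apply: ler_powR => //; lra.
apply: (@le_trans _ _ (`|C0| * (x ^+ 2)^-1 * (12 * x ^+ 2))).
  apply: ler_pM => //; first by rewrite -Sigma1E sigmoidal_ge0.
  nra.
by rewrite mulrACA mulVf ?mulr1// expf_neq0// gt_eqF.
Qed.

Lemma sum_phi_sigma_half alpha : Sigma3 sigma alpha -> 1 < alpha ->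
  exists C, forall v M, 0 <= v <= 1 ->
    \sum_(0 <= m < M) phi_sigma sigma (v + m%:R) * (1 + (v + m%:R)) <= C.
Proof.
move=> s3 alpha1; have [C hC] := sigmoidal_tail s3 alpha1.
case: (sg) => ndec _.
exists (2^-1 * (4 * C)) => v M /andP[v0 v1].
(* With this tail, [tau m - tau m.+2] is twice [phi_sigma] at [v + m], and [v <= 1] bounds the
   weight by [m + 2]. *)
pose tau m := 1 - sigma (v + m%:R - 1).
have hm m : 0 <= m%:R :> R by [].
have le2 : \sum_(0 <= m < M) m.+2%:R * (tau m - tau m.+2) <= 4 * C.
  apply: sum_second_diff_le => m; rewrite /tau -Sigma1E sigmoidal_ge0/=.
  rewrite Sigma1E ler_pdivlMr ?mulr_gt0//.
  apply: le_trans (hC (v + m%:R - 1) _); last by have := hm m; lra.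
  rewrite ler_wpM2l//; first by rewrite -Sigma1E sigmoidal_ge0.
  rewrite -!natr1; have := hm m.
  by move=> ?; apply: ler_pM; lra.
apply: (@le_trans _ _
    (2^-1 * \sum_(0 <= m < M) m.+2%:R * (tau m - tau m.+2))); last first.
  by rewrite ler_wpM2l.
rewrite mulr_sumr; apply: ler_sum => m _.
have -> : 2^-1 * (m.+2%:R * (tau m - tau m.+2))
          = phi_sigma sigma (v + m%:R) * m.+2%:R.
  rewrite /tau /phi_sigma -!natr1 (_ : v + (m%:R + 1 + 1) - 1 = v + m%:R + 1); ring.
rewrite ler_wpM2l ?phi_sigma_ge0// -!natr1; have := hm m; lra.
Qed.

(** Integers up to the floor of [u] lie at distances [v + m] from [u], with [v] the fractional part;
    the others lie at distances [(1 - v) + m]. Evenness reduces both halves to the one-sided sum. *)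
Lemma sum_phi_sigma_le alpha : Sigma3 sigma alpha -> 1 < alpha ->
  exists2 A, 0 <= A & forall (u : R) (r : seq int), uniq r ->
    \sum_(k <- r) phi_sigma sigma (u - k%:~R) * (1 + `|u - k%:~R|) <= A.
Proof.
move=> s3 alpha1; have [C hC] := sum_phi_sigma_half s3 alpha1.
have C0 : 0 <= C by have := hC 0 0%N; rewrite big_geq//; apply; rewrite lexx ler01.
exists (C + C); first by rewrite addr_ge0.
move=> u r ur; pose p := Num.floor u.
have p1 : p%:~R <= u by exact: floor_le.
have p2 : u < (p + 1)%:~R by exact: floorD1_gt.
have hm m : 0 <= m%:R :> R by [].
apply: (@sum_int_le_two_sided _ _ p) => // [k|M|M].
- by rewrite mulr_ge0 ?phi_sigma_ge0// addr_ge0.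
- apply: le_trans (hC (u - p%:~R) M _); last first.
    by move: p2; rewrite intrD; lra.
  rewrite le_eqVlt; apply/orP; left; apply/eqP.
  apply: eq_bigr => m _; rewrite (_ : u - _ = u - p%:~R + m%:R); last first.
    by rewrite intrB; ring.
  by rewrite ger0_norm// addr_ge0// subr_ge0.
- apply: le_trans (hC ((p + 1)%:~R - u) M _); last first.
    by move: p2; rewrite intrD; lra.
  rewrite le_eqVlt; apply/orP; left; apply/eqP.
  apply: eq_bigr => m _; rewrite (_ : u - _ = - ((p + 1)%:~R - u + m%:R)); last first.
    by rewrite !intrD; ring.
  by rewrite phi_sigma_even normrN ger0_norm// addr_ge0// subr_ge0 ltW.
Qed.

(** * The derivative of the kernel and its first moment *)

Lemma is_derive_phi_sigma (x : R) :
  is_derive x (1 : R) (phi_sigma sigma)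
    (2^-1 * (derive1 sigma (x + 1) - derive1 sigma (x - 1))).
Proof.
case: s2 => ds _.
have d1 (c : R) : is_derive x (1 : R) (sigma \o (+%R^~ c)) (derive1 sigma (x + c) * 1).
  apply: is_derive1_comp; last by apply: is_derive_eq; rewrite addr0.
  by rewrite derive1E; apply: DeriveDef.
rewrite (_ : phi_sigma sigma = 2^-1 \*: ((sigma \o +%R^~ 1) - (sigma \o +%R^~ (-1)))).
  by apply: is_derive_eq; rewrite !mulr1.
by apply/funext.
Qed.

Lemma derive1_phi_sigma_bounded :
  exists2 B, 0 <= B & forall u, `|u| <= 1 -> `|derive1 (phi_sigma sigma) u| <= B.
Proof.
case: (s2) => ds [dds _].
have cs : {within `[(-2)%R, 2%R], continuous (fun x => `|derive1 sigma x|)}.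
  apply: continuous_subspaceT => x; apply: continuous_comp; last exact: norm_continuous.
  exact/differentiable_continuous/derivable1_diffP.
have [|c _ hc] := EVT_max _ cs; first lra.
exists `|derive1 sigma c| => // u u1.
have -> : derive1 (phi_sigma sigma) u =
    2^-1 * (derive1 sigma (u + 1) - derive1 sigma (u - 1)).
  by rewrite derive1E; apply: derive_val; exact: is_derive_phi_sigma.
move: u1; rewrite ler_norml => /andP[u0 u1].
have h1 := hc (u + 1); have h2 := hc (u - 1).
rewrite !in_itv/= in h1 h2.
rewrite normrM ger0_norm ?invr_ge0// ler_pdivrMl//.
rewrite (le_trans (ler_normB _ _))//.
have := h1 ltac:(lra); have := h2 ltac:(lra); lra.
Qed.

Lemma sum_derive1_phi_sigma_le alpha : Sigma3 sigma alpha -> 1 < alpha ->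
  (M_beta 1 (derive1 (phi_sigma sigma)) < +oo)%E ->
  exists2 A, 0 <= A & forall (u : R) (r : seq int), uniq r ->
    \sum_(k <- r) `|derive1 (phi_sigma sigma) (u - k%:~R)| * (1 + `|u - k%:~R|) <= A.
Proof.
move=> s3 alpha1 M1.
have [A A0 hA] := sum_phi_sigma_le s3 alpha1.
have [B B0 hB] := derive1_phi_sigma_bounded.
have [c c0 hc] := phi_sigma_lower_bound.
set g := derive1 _ in M1 hB *.
have [D D0 hD] : exists2 D, 0 <= D & forall (u : R) (r : seq int), uniq r ->
    \sum_(k <- r) `|g (u - k%:~R)| * `|u - k%:~R| <= D.
  exists (fine (M_beta 1 g)).
    rewrite fine_ge0//; apply: (le_trans _ (ereal_sup_ubound _)); last by exists 0.
    by apply: esum_ge0 => k _; rewrite lee_fin mulr_ge0// powR_ge0.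
  move=> u r ur; rewrite -lee_fin.
  (* A finite list gives one of the partial sums whose supremum is the [esum] at the point [u]. *)
  have H : ((\sum_(k <- r) `|g (u - k%:~R)| * `|u - k%:~R|)%:E <= M_beta 1 g)%E.
    apply: (le_trans _ (ereal_sup_ubound _)); last by exists u.
    apply: esum_ge; exists [set` r]; first by split => //; exact: finite_seq.
    rewrite -fsbig_seq// sumEFin lee_fin; apply: ler_sum => k _.
    by rewrite powRr1// (distrC _ u).
  rewrite fineK// ge0_fin_numE// (le_trans _ H)// lee_fin.
  by apply: sumr_ge0 => k _; rewrite mulr_ge0.
(* [M_1] says nothing about [|y| <= 1]; there the constant [2 B] is absorbed by
   [phi_sigma y >= c], whose sum is already controlled. *)
exists (2 * D + 2 * B / c * A).
  by rewrite addr_ge0// ?mulr_ge0// invr_ge0 ltW.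
move=> u r ur.
apply: (@le_trans _ _ (\sum_(k <- r) (2 * (`|g (u - k%:~R)| * `|u - k%:~R|)
   + 2 * B / c * (phi_sigma sigma (u - k%:~R) * (1 + `|u - k%:~R|))))); last first.
  rewrite big_split/= -!mulr_sumr lerD// ler_wpM2l// ?hD ?hA//.
  by rewrite !mulr_ge0// invr_ge0 ltW.
apply: ler_sum => k _; move: (u - k%:~R) => y.
have gy : 0 <= `|g y| by [].
have py := phi_sigma_ge0 y.
have Bc : 0 <= 2 * B / c by rewrite !mulr_ge0// invr_ge0 ltW.
have [y1|y1] := lerP `|y| 1.
  rewrite -[leLHS]add0r lerD ?mulr_ge0// mulrA ler_pM//.
    apply: (@le_trans _ _ (2 * B / c * c)); last by rewrite ler_wpM2l// hc.
    by rewrite divfK ?gt_eqF//; have := hB _ y1; lra.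
(* Here [1 + |y| <= 2 * |y|], so the term controlled by [D] suffices. *)
have h1 : `|g y| * 1 <= `|g y| * `|y| by rewrite ler_wpM2l// ltW.
have h2 : 0 <= 2 * B / c * (phi_sigma sigma y * (1 + `|y|)).
  by rewrite (mulr_ge0 Bc)// mulr_ge0// addr_ge0.
by rewrite mulrDr; lra.
Qed.

End Phi.

(** * One-dimensional weights *)

Lemma is_derive_big_sum (R : realType) (I : Type) (r : seq I) (P : pred I)
    (F : I -> R -> R) (dF : I -> R) (x : R) :
  (forall i, P i -> is_derive x (1 : R) (F i) (dF i)) ->
  is_derive x (1 : R) (fun t => \sum_(i <- r | P i) F i t) (\sum_(i <- r | P i) dF i).
Proof.
move=> H; elim: r => [|i r IH].
  rewrite big_nil (_ : (fun t => _) = cst 0); first exact: is_derive_cst.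
  by apply/funext => t; rewrite big_nil.
have [Pi|nPi] := boolP (P i); last first.
  rewrite big_cons (negbTE nPi) (_ : (fun t => _) = fun t => \sum_(i <- r | P i) F i t)//.
  by apply/funext => t; rewrite big_cons (negbTE nPi).
rewrite big_cons Pi (_ : (fun t => _) = F i + fun t => \sum_(i <- r | P i) F i t).
  by have Hi := H i Pi; apply: is_deriveD.
by apply/funext => t; rewrite big_cons Pi.
Qed.

Section Weights.
Variables (R : realType) (phi dphi : R -> R) (c A0 A1 : R).
Hypotheses (c_gt0 : 0 < c) (phi_ge0 : forall u, 0 <= phi u)
  (phi_ge : forall u, `|u| <= 1 -> c <= phi u)
  (phi_derive : forall u, is_derive u (1 : R) phi (dphi u))
  (phi_sum : forall u (r : seq int), uniq r ->
     \sum_(k <- r) phi (u - k%:~R) * (1 + `|u - k%:~R|) <= A0)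
  (dphi_sum : forall u (r : seq int), uniq r ->
     \sum_(k <- r) `|dphi (u - k%:~R)| * (1 + `|u - k%:~R|) <= A1).
Variables (T : finType) (kap : T -> int) (kap_inj : injective kap).

(** Nodes are indexed by a finite type embedded in the integers by [kap], with [Q] selecting the
    admissible ones in one coordinate, so that sums and products over families can be exchanged. *)
Definition wsum (Q : pred T) (n : nat) (t : R) : R :=
  \sum_(j | Q j) phi (n%:R * t - (kap j)%:~R).
Definition dwsum (Q : pred T) (n : nat) (t : R) : R :=
  \sum_(j | Q j) dphi (n%:R * t - (kap j)%:~R).
Definition weight (Q : pred T) (n : nat) (k : T) (t : R) : R :=
  phi (n%:R * t - (kap k)%:~R) / wsum Q n t.
(** The quotient rule applied to [weight]. *)
Definition dweight (Q : pred T) (n : nat) (k : T) (t : R) : R :=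
  n%:R * (dphi (n%:R * t - (kap k)%:~R) / wsum Q n t
          - phi (n%:R * t - (kap k)%:~R) * dwsum Q n t / wsum Q n t ^+ 2).

Lemma sum_kap (Q : pred T) (F : int -> R) :
  \sum_(j | Q j) F (kap j) = \sum_(k <- [seq kap j | j <- enum Q]) F k.
Proof. by rewrite big_map big_enum. Qed.

Lemma uniq_kap (Q : pred T) : uniq [seq kap j | j <- enum Q].
Proof. by rewrite map_inj_uniq// enum_uniq. Qed.

Lemma dphi_sum_kap (Q : pred T) u :
  \sum_(j | Q j) `|dphi (u - (kap j)%:~R)| * (1 + `|u - (kap j)%:~R|) <= A1.
Proof.
rewrite (sum_kap Q (fun k => `|dphi (u - k%:~R)| * (1 + `|u - k%:~R|))).
exact/dphi_sum/uniq_kap.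
Qed.

Lemma phi_sum_kap (Q : pred T) u :
  \sum_(j | Q j) phi (u - (kap j)%:~R) * (1 + `|u - (kap j)%:~R|) <= A0.
Proof.
rewrite (sum_kap Q (fun k => phi (u - k%:~R) * (1 + `|u - k%:~R|))).
exact/phi_sum/uniq_kap.
Qed.

Lemma phi_moment_ge0 : 0 <= A0.
Proof. by have := @phi_sum 0 [::] isT; rewrite big_nil. Qed.

Lemma dphi_moment_ge0 : 0 <= A1.
Proof. by have := @dphi_sum 0 [::] isT; rewrite big_nil. Qed.

Section Fixed.
Variables (Q : pred T) (n : nat) (t : R).
Hypothesis near_node : exists2 k, Q k & `|n%:R * t - (kap k)%:~R| <= 1.

Lemma wsum_ge : c <= wsum Q n t.
Proof.
case: near_node => k Qk hk; rewrite /wsum (bigD1 k)//=.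
by rewrite -[c]addr0 lerD ?phi_ge// sumr_ge0.
Qed.

Lemma wsum_gt0 : 0 < wsum Q n t.
Proof. exact: lt_le_trans c_gt0 wsum_ge. Qed.

Lemma weight_ge0 k : 0 <= weight Q n k t.
Proof. by rewrite /weight divr_ge0// ltW// wsum_gt0. Qed.

Lemma sum_weight_dist :
  \sum_(k | Q k) weight Q n k t * (1 + `|n%:R * t - (kap k)%:~R|) <= A0 / c.
Proof.
have S0 := wsum_gt0.
apply: (@le_trans _ _ (A0 / wsum Q n t)); last first.
  by rewrite ler_wpM2l ?phi_moment_ge0// lef_pV2 ?posrE// wsum_ge.
rewrite ler_pdivlMr// mulr_suml (le_trans _ (phi_sum_kap Q (n%:R * t)))//.
by apply: ler_sum => k _; rewrite mulrAC divfK ?gt_eqF.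
Qed.

(** The weights sum to the constant 1; the cancellation is read off the quotient rule. *)
Lemma sum_dweight : \sum_(k | Q k) dweight Q n k t = 0.
Proof.
rewrite -mulr_sumr big_split/= -mulr_suml sumrN -!mulr_suml.
rewrite -/(wsum Q n t) -/(dwsum Q n t).
have S0 := wsum_gt0.
by rewrite expr2; field; rewrite gt_eqF.
Qed.

Lemma is_derive_weight k : is_derive t (1 : R) (weight Q n k) (dweight Q n k t).
Proof.
have dp j : is_derive t (1 : R) (fun s => phi (n%:R * s - (kap j)%:~R))
    (dphi (n%:R * t - (kap j)%:~R) * n%:R).
  apply: (@is_derive1_comp _ phi (fun s => n%:R * s - (kap j)%:~R)).
  have -> : (fun s => n%:R * s - (kap j)%:~R) = (n%:R \*: id) - cst (kap j)%:~R :> (R -> R).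
    by apply/funext.
  by apply: is_derive_eq; rewrite subr0 /GRing.scale/= mulr1.
have dS : is_derive t (1 : R) (wsum Q n)
    (\sum_(j | Q j) dphi (n%:R * t - (kap j)%:~R) * n%:R).
  by apply: is_derive_big_sum.
have S0 : wsum Q n t != 0 by rewrite gt_eqF// wsum_gt0.
have dV := is_deriveV S0 dS.
rewrite (_ : weight Q n k = (fun s => phi (n%:R * s - (kap k)%:~R))
    * (fun s => (wsum Q n s)^-1)); last by apply/funext.
apply: is_derive_eq; rewrite -mulr_suml -/(dwsum Q n t) /dweight /GRing.scale/=.
by field.
Qed.

(** The two terms of the quotient rule are bounded separately: [A1 / c] comes from differentiating
    the numerator, [A0 * A1 / c ^+ 2] from differentiating the denominator, whose derivative sum is
    at most [A1]. *)
Lemma sum_dweight_dist :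
  \sum_(k | Q k) `|dweight Q n k t| * (1 + `|n%:R * t - (kap k)%:~R|)
    <= n%:R * (A1 / c + A0 * A1 / c ^+ 2).
Proof.
have S0 := wsum_gt0; have Sc := wsum_ge; have A0p := phi_moment_ge0; have A1p := dphi_moment_ge0.
set u := n%:R * t.
have hdS : `|dwsum Q n t| <= A1.
  rewrite (le_trans (ler_norm_sum _ _ _))//.
  apply: le_trans (dphi_sum_kap Q u); apply: ler_sum => k _.
  by rewrite ler_peMr// lerDl.
apply: (@le_trans _ _ (n%:R * (
    (\sum_(k | Q k) `|dphi (u - (kap k)%:~R)| * (1 + `|u - (kap k)%:~R|)) / wsum Q n t
  + (\sum_(k | Q k) phi (u - (kap k)%:~R) * (1 + `|u - (kap k)%:~R|))
     * `|dwsum Q n t| / wsum Q n t ^+ 2))).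
  rewrite !mulr_suml -big_split/= mulr_sumr; apply: ler_sum => k _.
  rewrite /dweight normrM normr_nat -[leLHS]mulrA ler_wpM2l// -/u.
  set y := u - _.
  have n1 : 0 <= 1 + `|y| by rewrite addr_ge0.
  apply: (@le_trans _ _ ((`|dphi y| / wsum Q n t
      + phi y * `|dwsum Q n t| / wsum Q n t ^+ 2) * (1 + `|y|))).
    rewrite ler_wpM2r// (le_trans (ler_normB _ _))// !normrM !normfV normrX.
    by rewrite (gtr0_norm S0) (ger0_norm (phi_ge0 _)).
  rewrite le_eqVlt; apply/orP; left; apply/eqP; field.
  by rewrite gt_eqF.
have c2 : 0 < c ^+ 2 by rewrite exprn_gt0.
have S2 : 0 < wsum Q n t ^+ 2 by rewrite exprn_gt0.
rewrite ler_wpM2l// lerD//.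
  rewrite ler_pM ?invr_ge0 ?(ltW S0) ?dphi_sum_kap// ?lef_pV2 ?posrE//.
  by apply: sumr_ge0 => k _; rewrite mulr_ge0// addr_ge0.
rewrite ler_pM ?invr_ge0 ?(ltW S2)//.
- rewrite mulr_ge0//.
  by apply: sumr_ge0 => k _; rewrite mulr_ge0// addr_ge0.
- rewrite ler_pM ?phi_sum_kap//.
  by apply: sumr_ge0 => k _; rewrite mulr_ge0// addr_ge0.
- by rewrite lef_pV2 ?posrE// ler_pXn2r// nnegrE ltW.
Qed.

End Fixed.
End Weights.

(** * The multivariate operator *)

Section Oscillation.
Variables (R : realType) (d : nat) (a b : 'I_d -> R) (g : ('I_d -> R) -> R).

Definition in_box (x : 'I_d -> R) := forall i, a i <= x i <= b i.

(** A modulus of continuity as a relation, avoiding suprema, and measured coordinatewise, which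
    suits changing one coordinate at a time. *)
Definition osc_le (delta omega : R) :=
  forall x y, in_box x -> in_box y -> (forall i, `|x i - y i| <= delta) ->
    `|g x - g y| <= omega.

(** The box is convex, so the segment from [x] to [y] can be cut into [m] equal steps inside it; in
    the induction [z] is the end of the first step. *)
Lemma osc_le_mulrn (delta omega : R) (m : nat) x y : osc_le delta omega ->
  in_box x -> in_box y -> (forall i, `|x i - y i| <= m%:R * delta) ->
  `|g x - g y| <= m%:R * omega.
Proof.
move=> osc; elim: m x => [|m IH] x bx by_ hxy.
  suff -> : x = y by rewrite subrr normr0 mul0r.
  by apply/funext => i; have := hxy i; rewrite mul0r normr_le0 subr_eq0 => /eqP.
have m1 : 0 < m.+1%:R :> R by [].
pose z i := x i + (y i - x i) / m.+1%:R.
have mm : m.+1%:R = m%:R + 1 :> R by rewrite natr1.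
have m0 : 0 <= m%:R :> R by [].
have mi : 0 <= (m.+1%:R : R)^-1 <= 1.
  by rewrite invr_ge0 (ltW m1) invf_le1// ler1n.
have bz : in_box z.
  move=> i; rewrite /z; have := bx i; have := by_ i.
  case/andP: mi; move: (m.+1%:R^-1) => t t0 t1 /andP[? ?] /andP[? ?].
  by apply/andP; split; nra.
have xz i : `|x i - z i| <= delta.
  rewrite /z opprD addrA subrr add0r normrN normrM normfV (gtr0_norm m1).
  by rewrite ler_pdivrMr// mulrC distrC.
have zy i : `|z i - y i| <= m%:R * delta.
  have -> : z i - y i = m%:R * ((x i - y i) / m.+1%:R).
    by rewrite /z mm; field; rewrite -mm gt_eqF.
  rewrite normrM normr_nat ler_wpM2l// normrM normfV (gtr0_norm m1).
  by rewrite ler_pdivrMr// mulrC.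
have h1 := IH _ bz by_ zy; have h2 := osc _ _ bx bz xz.
rewrite mm mulrDl mul1r (le_trans (ler_distD (g z) _ _))//; lra.
Qed.
End Oscillation.

Section Multivariate.
Variables (R : realType) (phi dphi : R -> R) (c A0 A1 : R).
Hypotheses (c_gt0 : 0 < c) (phi_ge0 : forall u, 0 <= phi u)
  (phi_ge : forall u, `|u| <= 1 -> c <= phi u)
  (phi_derive : forall u, is_derive u (1 : R) phi (dphi u))
  (phi_sum : forall u (r : seq int), uniq r ->
     \sum_(k <- r) phi (u - k%:~R) * (1 + `|u - k%:~R|) <= A0)
  (dphi_sum : forall u (r : seq int), uniq r ->
     \sum_(k <- r) `|dphi (u - k%:~R)| * (1 + `|u - k%:~R|) <= A1).
Variables (T : finType) (kap : T -> int) (kap_inj : injective kap).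
Variables (d : nat) (a b : 'I_d -> R) (g : ('I_d -> R) -> R) (n : nat)
  (Q : 'I_d -> pred T).
Hypotheses (n_gt0 : (0 < n)%N)
  (near_node : forall i t, a i <= t <= b i ->
     exists2 k, Q i k & `|n%:R * t - (kap k)%:~R| <= 1).

Definition node (k : {ffun 'I_d -> T}) : 'I_d -> R :=
  fun i => (kap (k i))%:~R / n%:R.

Hypothesis node_box : forall k, k \in family Q -> in_box a b (node k).

Definition wop (x : 'I_d -> R) : R :=
  \sum_(k in family Q) g (node k) * \prod_i weight phi kap (Q i) n (k i) (x i).

Definition upd (x : 'I_d -> R) (i : 'I_d) (t : R) : 'I_d -> R :=
  fun j => if j == i then t else x j.

Definition dwop (x : 'I_d -> R) (i : 'I_d) (t : R) : R :=
  \sum_(k in family Q) g (node k) * \prod_j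
    (if j == i then dweight phi dphi kap (Q i) n (k i) t
     else weight phi kap (Q j) n (k j) (x j)).

Lemma in_box_upd x i t : in_box a b x -> a i <= t <= b i -> in_box a b (upd x i t).
Proof. by move=> bx ti j; rewrite /upd; case: eqP => [->|_]. Qed.

Lemma is_derive_wop x i t : a i <= t <= b i ->
  is_derive t (1 : R) (fun s => wop (upd x i s)) (dwop x i t).
Proof.
move=> ti; apply: is_derive_big_sum => k _.
pose P := \prod_(j | j != i) weight phi kap (Q j) n (k j) (x j).
have -> : \prod_j (if j == i then dweight phi dphi kap (Q i) n (k i) t
     else weight phi kap (Q j) n (k j) (x j)) = dweight phi dphi kap (Q i) n (k i) t * P.
  rewrite (bigD1 i)//= eqxx; congr (_ * _).
  by apply: eq_bigr => j /negbTE ->.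
have -> : (fun s => g (node k) * \prod_i0 weight phi kap (Q i0) n (k i0) (upd x i s i0))
   = (g (node k) * P) \*: weight phi kap (Q i) n (k i).
  apply/funext => s /=; rewrite (bigD1 i)//= {1}/upd eqxx /GRing.scale/=.
  rewrite [RHS]mulrAC -[RHS]mulrA; congr (_ * (_ * _)).
  by apply: eq_bigr => j /negbTE ji; rewrite /upd ji.
have dw := is_derive_weight c_gt0 phi_ge0 phi_ge phi_derive (near_node ti) (k i).
by apply: is_derive_eq; rewrite /GRing.scale/= mulrAC mulrA.
Qed.

(** The added 1 gives [E >= 1], so the product over the [d - 1] unchanged coordinates is bounded by
    [E ^+ d]. *)
Let E := A0 / c + 1.
Let D := A1 / c + A0 * A1 / c ^+ 2.

(** In each coordinate the node is within [(P - 1) / n] of [z], since every factor of [P] is at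
    least 1; as [P - 1] is below the integer part of [P], that many steps of size [1 / n] suffice. A
    product is used because it factors over the coordinates. *)
Lemma node_dist_le omega z k : osc_le a b g n%:R^-1 omega -> in_box a b z ->
  0 <= omega -> k \in family Q ->
  `|g (node k) - g z| <= omega * \prod_j (1 + `|n%:R * z j - (kap (k j))%:~R|).
Proof.
move=> osc bz omega0 kQ.
set P := \prod_j _.
have n0 : 0 < n%:R :> R by rewrite ltr0n.
have P0 : 0 <= P by apply: prodr_ge0 => j _; rewrite addr_ge0.
have hP j : 1 + `|n%:R * z j - (kap (k j))%:~R| <= P.
  rewrite /P (bigD1 j)//= ler_peMr ?addr_ge0//.
  by elim/big_ind: _ => // [u v u1 v1|i _]; rewrite ?lerDl// mulr_ege1.
have := truncn_itv P0 => /andP[m1]; rewrite -natr1 => m2.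
apply: (@le_trans _ _ ((Num.truncn P)%:R * omega)); last first.
  by rewrite mulrC ler_wpM2l.
apply: (osc_le_mulrn osc) => // [|j]; first exact: node_box.
have -> : node k j - z j = - (n%:R * z j - (kap (k j))%:~R) / n%:R.
  by rewrite /node; field; rewrite gt_eqF.
rewrite normrM normfV normrN (gtr0_norm n0) ler_wpM2r ?invr_ge0 ?ltW//.
by have := hP j; lra.
Qed.

Lemma dwop_le x i t omega : osc_le a b g n%:R^-1 omega -> 0 <= omega ->
  in_box a b x -> a i <= t <= b i ->
  `|dwop x i t| <= omega * (n%:R * D * E ^+ d).
Proof.
move=> osc omega0 bx ti.
pose z := upd x i t; have bz : in_box a b z by exact: in_box_upd.
pose W j l := if j == i then dweight phi dphi kap (Q i) n l t
              else weight phi kap (Q j) n l (x j).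
have A0p : 0 <= A0 := phi_moment_ge0 phi_sum.
have A1p : 0 <= A1 := dphi_moment_ge0 dphi_sum.
have E1 : 1 <= E by rewrite lerDr divr_ge0// ltW.
have D0 : 0 <= D.
  by rewrite addr_ge0// divr_ge0 ?mulr_ge0// ltW// exprn_gt0.
(* The sum factors over coordinates, and the factor at [i] vanishes; this allows subtracting [g z]
   from every node value. *)
have sW0 : \sum_(k in family Q) \prod_j W j (k j) = 0.
  rewrite -(bigA_distr_big_dep Q W) (bigD1 i)//= /W eqxx.
  by rewrite (sum_dweight dphi c_gt0 phi_ge0 phi_ge (near_node ti)) mul0r.
have -> : dwop x i t = \sum_(k in family Q) (g (node k) - g z) * \prod_j W j (k j).
  under [RHS]eq_bigr do rewrite mulrBl.
  rewrite sumrB -mulr_sumr sW0 mulr0 subr0; apply: eq_bigr => k _.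
  by congr (_ * _); apply: eq_bigr => j _; rewrite /W; case: eqP => // ->.
pose G j l := `|W j l| * (1 + `|n%:R * z j - (kap l)%:~R|).
apply: (@le_trans _ _ (omega * \sum_(k in family Q) \prod_j G j (k j))).
  rewrite mulr_sumr (le_trans (ler_norm_sum _ _ _))//; apply: ler_sum => k kQ.
  rewrite normrM normr_prod /G big_split/= mulrCA mulrC ler_wpM2l//.
    by apply: prodr_ge0.
  exact: node_dist_le.
rewrite ler_wpM2l// -(bigA_distr_big_dep Q G).
apply: (@le_trans _ _ (\prod_j (if j == i then n%:R * D else E))).
  apply: ler_prod => j _; apply/andP; split.
    by apply: sumr_ge0 => l _; rewrite mulr_ge0// addr_ge0.
  rewrite /G /W /z /upd; case: eqP => [->|_].
    exact: (sum_dweight_dist c_gt0 phi_ge0 phi_ge phi_sum dphi_sum kap_inj (near_node ti)).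
  have nn := near_node (bx j).
  apply: (@le_trans _ _ (A0 / c)); last by rewrite lerDl.
  apply: le_trans (sum_weight_dist c_gt0 phi_ge0 phi_ge phi_sum kap_inj nn).
  by apply: ler_sum => l _; rewrite ger0_norm// (weight_ge0 c_gt0 phi_ge0 phi_ge).
rewrite (bigD1 i)//= eqxx ler_wpM2l ?mulr_ge0//.
apply: (@le_trans _ _ (\prod_(j < d | j != i) E)).
  by apply: ler_prod => j /negbTE ->; rewrite lexx andbT (le_trans _ E1).
have -> : E ^+ d = \prod_(j < d) E by rewrite prodr_const card_ord.
rewrite [leRHS](bigD1 i)//= ler_peMl//.
by apply: prodr_ge0 => j _; rewrite (le_trans _ E1).
Qed.

Lemma wop_upd_le x i s t omega : osc_le a b g n%:R^-1 omega -> 0 <= omega ->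
  in_box a b x -> a i <= s <= b i -> a i <= t <= b i ->
  `|wop (upd x i t) - wop (upd x i s)| <= omega * (n%:R * D * E ^+ d) * `|t - s|.
Proof.
move=> osc omega0 bx.
wlog st : s t / s <= t.
  move=> H hs ht; have [st|/ltW ts] := leP s t; first exact: H.
  by rewrite distrC (distrC t); apply: H.
move=> /andP[s1 s2] /andP[t1 t2].
have itv u : s <= u <= t -> a i <= u <= b i.
  by case/andP => u1 u2; rewrite (le_trans s1)//= (le_trans u2).
have dw u : u \in `]s, t[ -> is_derive u (1 : R) (fun v => wop (upd x i v)) (dwop x i u).
  rewrite in_itv/= => /andP[/ltW u1 /ltW u2].
  by apply/is_derive_wop/itv; rewrite u1.
have cw : {within `[s, t], continuous (fun v => wop (upd x i v))}.
  apply: derivable_within_continuous => u; rewrite in_itv/= => hu.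
  by have h := is_derive_wop x (itv _ hu); apply: ex_derive.
(* The mean value theorem turns the bound on the partial derivative into a Lipschitz bound in one
   coordinate. *)
have [u + ->] := MVT_segment st dw cw.
rewrite in_itv/= => /itv hu.
by rewrite normrM ler_wpM2r// dwop_le.
Qed.

Lemma wop_lipschitz x y omega delta : osc_le a b g n%:R^-1 omega -> 0 <= omega ->
  in_box a b x -> in_box a b y -> (forall i, `|x i - y i| <= delta) -> 0 <= delta ->
  `|wop x - wop y| <= d%:R * (omega * (n%:R * D * E ^+ d) * delta).
Proof.
move=> osc omega0 bx by_ hxy delta0.
set B := omega * _ * delta.
have A0p : 0 <= A0 := phi_moment_ge0 phi_sum.
have A1p : 0 <= A1 := dphi_moment_ge0 dphi_sum.
have K0 : 0 <= omega * (n%:R * D * E ^+ d).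
  have D0 : 0 <= D by rewrite addr_ge0// divr_ge0 ?mulr_ge0// ltW// exprn_gt0.
  have E0 : 0 <= E by rewrite addr_ge0// divr_ge0// ltW.
  by rewrite mulr_ge0// !mulr_ge0// exprn_ge0.
have B0 : 0 <= B by rewrite /B mulr_ge0.
(* Coordinates of [x] are replaced by those of [y] one at a time: [m] counts those that may still
   differ, and each replacement costs at most [B]. *)
suff : forall m x, in_box a b x -> (forall i, `|x i - y i| <= delta) ->
    (forall j : 'I_d, (m <= j)%N -> x j = y j) -> `|wop x - wop y| <= m%:R * B.
  by move=> /(_ d x bx hxy); apply => j; rewrite leqNgt ltn_ord.
elim => [|m IH] {bx hxy} {}x bx hxy xy.
  suff -> : x = y by rewrite subrr normr0 mul0r.
  by apply/funext => j; exact: xy.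
have [md|dm] := ltnP m d; last first.
  apply: (@le_trans _ _ (m%:R * B)); last by rewrite ler_wpM2r// ler_nat.
  by apply: IH => // j mj; have := ltn_ord j; lia.
pose i := Ordinal md.
have xE : x = upd x i (x i) by apply/funext => j; rewrite /upd; case: eqP => [->|].
pose x' := upd x i (y i).
have bx' : in_box a b x' by exact: in_box_upd.
have h1 : `|wop x - wop x'| <= B.
  rewrite {1}xE (le_trans (wop_upd_le osc omega0 bx (by_ i) (bx i)))//.
  by rewrite ler_wpM2l.
have h2 : `|wop x' - wop y| <= m%:R * B.
  apply: IH => // j; first by rewrite /x' /upd; case: eqP => [->|//]; rewrite subrr normr0.
  move=> mj; rewrite /x' /upd; case: eqP => [->//|ji]; apply: xy.
  rewrite ltn_neqAle mj andbT; apply/eqP => mj'; apply: ji.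
  by apply/val_inj.
by rewrite (le_trans (ler_distD (wop x') _ _))// -natr1 mulrDl mul1r [leRHS]addrC lerD.
Qed.

End Multivariate.

(** * The Berens-Lorentz iteration *)

Section BerensLorentz.
Variables (R : realType) (d : nat) (a b : 'I_d -> R) (g : ('I_d -> R) -> R).

Lemma osc_le_trans delta w w' : osc_le a b g delta w -> w <= w' ->
  osc_le a b g delta w'.
Proof. by move=> h ww x y bx by_ xy; apply: le_trans ww; exact: h. Qed.

Lemma osc_le_mono delta delta' w : osc_le a b g delta' w -> delta <= delta' ->
  osc_le a b g delta w.
Proof. by move=> h dd x y bx by_ xy; apply: h => // i; exact: le_trans dd. Qed.

Lemma osc_le_bootstrap (K C W nu : R) (N0 : nat) :
  0 <= K -> 0 <= C -> 0 < nu < 1 -> (0 < N0)%N ->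
  (forall delta, osc_le a b g delta W) -> 0 <= W ->
  (forall n w delta, (N0 <= n)%N -> 0 <= w -> 0 <= delta ->
     osc_le a b g n%:R^-1 w ->
     osc_le a b g delta (2 * C * n%:R `^ (- nu) + K * n%:R * w * delta)) ->
  exists2 L, 0 <= L & forall delta, 0 < delta < N0%:R^-1 ->
    osc_le a b g delta (L * delta `^ nu).
Proof.
move=> K0 C0 /andP[nu0 nu1] N00 gW W0 step.
have [A [A2 KA]] : exists A : nat, (2 <= A)%N /\ K / A%:R <= 2^-1 * A%:R `^ (- nu).
  (* Any [A >= z] satisfies [2 * K <= A ^ (1 - nu)], which is the required inequality; taking
     [A >= 2] makes the scales [N0 * A ^ j] unbounded. *)
  pose z := (2 * K) `^ (1 - nu)^-1.
  exists (Num.truncn z).+2; split => //; set A := _.+2.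
  have Ap : 0 < A%:R :> R by [].
  have zA : z <= A%:R.
    by rewrite ltW// (lt_le_trans (truncnS_gt z))// ler_nat /A leqW.
  have : 2 * K <= A%:R `^ (1 - nu).
    have -> : 2 * K = z `^ (1 - nu).
      by rewrite /z -powRrM mulVf ?powRr1 ?mulr_ge0// gt_eqF// subr_gt0.
    have h1 : 0 <= 1 - nu by rewrite subr_ge0 ltW.
    have h2 : z \in Num.nneg by rewrite nnegrE powR_ge0.
    have h3 : (A%:R : R) \in Num.nneg by rewrite nnegrE.
    exact: (ge0_ler_powR h1 h2 h3 zA).
  have Ann : (1 - nu == 0) ==> ((A%:R : R) != 0) by apply/implyP => _; rewrite gt_eqF.
  rewrite powRD// powRr1// => h.
  rewrite ler_pdivrMr//; lra.
have Ap : 0 < A%:R :> R by rewrite ltr0n; lia.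
have AnuV : A%:R `^ nu * A%:R `^ (- nu) = 1 :> R.
  by rewrite powRN divff// gt_eqF// powR_gt0.
have Np : 0 < N0%:R :> R by rewrite ltr0n.
have NnuV : N0%:R `^ nu * N0%:R `^ (- nu) = 1 :> R.
  by rewrite powRN divff// gt_eqF// powR_gt0.
(* The first term lets [2 * C] be absorbed into half of [B * A ^ (- nu)]; the second covers the
   initial scale, where only the crude bound [W] is known. *)
pose B := 4 * C * A%:R `^ nu + W * N0%:R `^ nu.
have B0 : 0 <= B by rewrite addr_ge0 ?mulr_ge0 ?powR_ge0.
pose n j := (N0 * A ^ j)%N.
have nN j : (N0 <= n j)%N by rewrite leq_pmulr// expn_gt0; lia.
have np j : 0 < (n j)%:R :> R by rewrite ltr0n (leq_trans N00).
have nS j : (n j.+1)%:R = A%:R * (n j)%:R :> R.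
  by rewrite -natrM /n expnS; congr (_%:R); lia.
(* In the induction step the approximation error and the Lipschitz term each take at most half of
   the new bound. *)
have osc j : osc_le a b g (n j)%:R^-1 (B * (n j)%:R `^ (- nu)).
  elim: j => [|j IH].
    apply: (osc_le_trans (gW _)); rewrite /n expn0 muln1 /B mulrDl.
    by rewrite -[W * _ * _]mulrA NnuV mulr1 lerDr !mulr_ge0 ?powR_ge0.
  have w0 : 0 <= B * (n j)%:R `^ (- nu) by rewrite mulr_ge0 ?powR_ge0.
  have d0 : 0 <= (n j.+1)%:R^-1 :> R by rewrite invr_ge0 ltW.
  apply: (osc_le_trans (step _ _ _ (nN j) w0 d0 IH)).
  rewrite nS powRM ?(ltW Ap) ?(ltW (np j))//.
  have -> : K * (n j)%:R * (B * (n j)%:R `^ (- nu)) * (A%:R * (n j)%:R)^-1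
      = B * (K / A%:R) * (n j)%:R `^ (- nu).
    by field; rewrite !gt_eqF.
  rewrite [leRHS]mulrA -mulrDl ler_wpM2r ?powR_ge0//.
  have hB : B * (K / A%:R) <= B * (2^-1 * A%:R `^ (- nu)) by rewrite ler_wpM2l.
  have hC : 4 * C <= B * A%:R `^ (- nu).
    rewrite /B [leRHS]mulrDl -[(4 * C * _) * _]mulrA AnuV mulr1 lerDl.
    by rewrite !mulr_ge0 ?powR_ge0.
  lra.
exists (B * A%:R `^ nu); first by rewrite mulr_ge0 ?powR_ge0.
move=> delta /andP[delta0 deltaN].
have exj : exists j, delta^-1 < (n j)%:R.
  exists (Num.truncn delta^-1).+1.
  rewrite (lt_le_trans (truncnS_gt _))// ler_nat.
  rewrite (leq_trans (ltnW (ltn_expl _ A2)))// leq_pmull//.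
(* The least such index is not 0 because [delta < 1 / N0], so [1 / delta] lies between consecutive
   scales; the ratio [A] between them costs the factor [A ^ nu] in [L]. *)
case: (ex_minnP exj) => -[|j] hj minj.
  move: hj; rewrite /n expn0 muln1 => hj.
  have : N0%:R < delta^-1 by rewrite -[ltLHS]invrK ltf_pV2 ?posrE ?invr_gt0.
  by move=> /(lt_trans hj); rewrite ltxx.
have hj' : (n j)%:R <= delta^-1.
  by rewrite leNgt; apply/negP => /minj; rewrite ltnn.
have dn : delta <= (n j)%:R^-1 by rewrite -[leLHS]invrK lef_pV2 ?posrE ?invr_gt0.
apply: (osc_le_trans (osc_le_mono (osc j) dn)).
rewrite -mulrA ler_wpM2l//.
have -> : (n j)%:R `^ (- nu) = A%:R `^ nu * (n j.+1)%:R `^ (- nu) :> R.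
  by rewrite nS powRM ?(ltW Ap) ?(ltW (np j))// mulrA AnuV mul1r.
rewrite ler_wpM2l ?powR_ge0//.
have -> : (n j.+1)%:R `^ (- nu) = (n j.+1)%:R^-1 `^ nu :> R.
  by rewrite -powR_inv1 ?(ltW (np _))// -powRrM mulN1r.
apply: ge0_ler_powR; rewrite ?nnegrE ?invr_ge0 ?(ltW nu0) ?(ltW delta0)//.
by rewrite ltW// -[ltRHS]invrK ltf_pV2 ?posrE ?invr_gt0.
Qed.
End BerensLorentz.

(** The floor of [u] works unless it falls below [v]; then its successor is less than [v + 1], hence
    at most [w]. *)
Lemma exists_near_int (R : realType) (u v w : R) : v <= u <= w -> 1 <= w - v ->
  exists2 k : int, Num.ceil v <= k <= Num.floor w & `|u - k%:~R| <= 1.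
Proof.
move=> /andP[vu uw] vw.
have [h|h] := leP v (Num.floor u)%:~R.
  exists (Num.floor u).
    by rewrite ceil_le_int h floor_ge_int (le_trans (floor_le u)).
  have := floor_itv u; rewrite intrD ler_norml; lra.
exists (Num.floor u + 1).
  have := floor_itv u; rewrite ceil_le_int floor_ge_int intrD; lra.
have := floor_itv u; rewrite intrD ler_norml; lra.
Qed.

(** * The operator F_n *)

Section Operator.
Variables (R : realType) (sigma : R -> R) (d : nat) (a b : 'I_d -> R)
  (f : 'rV[R]_d -> R) (n : nat).
Variables (T : finType) (kap : T -> int) (kap_inj : injective kap).

Definition in_Jn (i : 'I_d) : pred T :=
  fun j => Num.ceil (n%:R * a i) <= kap j <= Num.floor (n%:R * b i).

Hypothesis kap_surj : forall i k,
  Num.ceil (n%:R * a i) <= k <= Num.floor (n%:R * b i) -> exists j, kap j = k.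

(** Composition with [kap] maps the finite family bijectively onto [Jn], so the sum over a set
    becomes a big operator over a finite type. *)
Lemma sum_Jn (G : {ffun 'I_d -> int} -> R) :
  \sum_(k \in Jn a b n) G k
  = \sum_(k in family in_Jn) G [ffun i => kap (k i)].
Proof.
pose h (k : {ffun 'I_d -> T}) := [ffun i => kap (k i)] : {ffun 'I_d -> int}.
have h_inj : injective h.
  move=> k1 k2 /ffunP h12; apply/ffunP => i.
  by have := h12 i; rewrite !ffunE => /kap_inj.
have -> : Jn a b n = [set` [seq h k | k <- enum (family in_Jn)]].
  apply/seteqP; split => [k Jk|k] /=.
    have js i : exists j, kap j = k i by exact/kap_surj/Jk.
    have [j hj] := choice js.
    apply/mapP; exists (finfun j); last by apply/ffunP => i; rewrite !ffunE.
    by rewrite mem_enum; apply/familyP => i; rewrite ffunE unfold_in /in_Jn hj; exact: Jk.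
  by case/mapP => k'; rewrite mem_enum => /familyP hk' -> i; rewrite ffunE; exact: hk'.
rewrite -fsbig_seq ?map_inj_uniq ?enum_uniq//.
by rewrite big_map big_enum.
Qed.

(** The denominator, a sum of products over a product index set, is the product of the
    one-dimensional sums; each quotient then splits into one-dimensional weights. *)
Lemma Fn_wop x : Fn sigma a b f n x
  = wop (phi_sigma sigma) kap (fun v => f (\row_i v i)) n in_Jn (fun i => x ord0 i).
Proof.
rewrite /Fn !sum_Jn /wop.
have -> : \sum_(k in family in_Jn) Psi_sigma sigma
      (fun i => n%:R * x ord0 i - ([ffun i0 => kap (k i0)] i)%:~R)
    = \prod_i wsum (phi_sigma sigma) kap (in_Jn i) n (x ord0 i).
  rewrite /wsum (bigA_distr_big_dep in_Jn
    (fun i j => phi_sigma sigma (n%:R * x ord0 i - (kap j)%:~R))).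
  by apply: eq_bigr => k _; apply: eq_bigr => i _; rewrite ffunE.
rewrite mulr_suml; apply: eq_bigr => k _; rewrite -mulrA; congr (_ * _).
  by congr f; apply/rowP => i; rewrite !mxE /node ffunE.
rewrite -prodf_div; apply: eq_bigr => i _.
by rewrite /weight ffunE.
Qed.
End Operator.

(** [K] is chosen before [f] and [n], as the iteration over scales requires. The condition on [n]
    gives every point of the box a node within distance [1 / n] in each coordinate. *)
Lemma Fn_lipschitz (R : realType) (sigma : R -> R) (alpha : R) (d : nat) :
  sigmoidal sigma -> Sigma1 sigma -> Sigma2 sigma ->
  Sigma3 sigma alpha -> 1 < alpha ->
  (M_beta 1 (derive1 (phi_sigma sigma)) < +oo)%E ->
  exists2 K, 0 <= K & forall (a b : 'I_d -> R) (f : 'rV[R]_d -> R) n,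
    (0 < n)%N -> (forall i, 1 <= n%:R * (b i - a i)) ->
    forall w delta (x y : 'rV[R]_d), 0 <= w -> 0 <= delta ->
    osc_le a b (fun v => f (\row_i v i)) n%:R^-1 w ->
    box a b x -> box a b y -> (forall i, `|x ord0 i - y ord0 i| <= delta) ->
    `|Fn sigma a b f n x - Fn sigma a b f n y| <= K * n%:R * w * delta.
Proof.
move=> sg s1 s2 s3 alpha1 M1.
have [A0 A00 hA0] := sum_phi_sigma_le sg s1 s3 alpha1.
have [A1 A10 hA1] := sum_derive1_phi_sigma_le sg s1 s2 s3 alpha1 M1.
have [c c0 hc] := phi_sigma_lower_bound sg s1 s2.
have phi0 := phi_sigma_ge0 sg.
have dphi u : is_derive u (1 : R) (phi_sigma sigma) (derive1 (phi_sigma sigma) u).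
  have h := is_derive_phi_sigma s2 u.
  by rewrite derive1E; apply: DeriveDef.
exists (d%:R * ((A1 / c + A0 * A1 / c ^+ 2) * (A0 / c + 1) ^+ d)).
  have c2 : 0 <= c ^+ 2 by rewrite exprn_ge0// ltW.
  rewrite !mulr_ge0// ?exprn_ge0// addr_ge0// ?divr_ge0 ?mulr_ge0 ?(ltW c0)//.
move=> a b f n n0 nab w delta x y w0 delta0 osc bx by_ xy.
have n0' : 0 < n%:R :> R by rewrite ltr0n.
(* [M] bounds the absolute values of all range endpoints at once, so the integers from [-M] to [M]
   contain the range of every coordinate. *)
pose M := (\sum_i (`|Num.ceil (n%:R * a i)| + `|Num.floor (n%:R * b i)|))%N.
pose kap (j : 'I_(M + M).+1) : int := (j : nat)%:Z - M%:Z.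
have kap_inj : injective kap by move=> j j' /addIr [] /val_inj.
have kap_surj i (k : int) : Num.ceil (n%:R * a i) <= k <= Num.floor (n%:R * b i) ->
    exists j, kap j = k.
  have : (`|Num.ceil (n%:R * a i)| + `|Num.floor (n%:R * b i)| <= M)%N.
    by rewrite /M (bigD1 i)//= leq_addr.
  move: (Num.ceil _) (Num.floor _) => p q hM hk.
  have kM : (absz (k + M%:Z)%R < (M + M).+1)%N by lia.
  by exists (Ordinal kM); rewrite /kap/=; lia.
rewrite !(Fn_wop sigma f kap_inj kap_surj).
have near_node i t : a i <= t <= b i ->
    exists2 k, in_Jn a b n kap i k & `|n%:R * t - (kap k)%:~R| <= 1.
  move=> /andP[t1 t2].
  have [||k hk kt] := @exists_near_int _ (n%:R * t) (n%:R * a i) (n%:R * b i).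
  - by rewrite !ler_wpM2l.
  - by rewrite -mulrBr.
  by have [j jk] := kap_surj _ _ hk; exists j; rewrite /in_Jn jk.
have node_box k : k \in family (in_Jn a b n kap) -> in_box a b (node R kap n k).
  move=> /familyP hk i; have := hk i; rewrite unfold_in /in_Jn /node.
  rewrite ceil_le_int floor_ge_int => /andP[h1 h2].
  by rewrite ler_pdivlMr// ler_pdivrMr// mulrC h1 mulrC.
apply: (le_trans (wop_lipschitz c0 phi0 hc dphi hA0 hA1 kap_inj n0 near_node
  node_box osc w0 bx by_ xy delta0)).
by rewrite le_eqVlt; apply/predU1P; left; ring.
Qed.

(** * Boundedness on the box and the Lipschitz conclusion *)

Lemma coord_le_norm2 (R : realType) d (v : 'rV[R]_d) i : `|v ord0 i| <= norm2 v.
Proof.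
rewrite -sqrtr_sqr /norm2 ler_wsqrtr// (bigD1 i)//= lerDl.
by apply: sumr_ge0 => j _; exact: sqr_ge0.
Qed.

Lemma box_bounded (R : realType) d (a b : 'I_d -> R) (f : 'rV[R]_d -> R) :
  CI (box a b) f -> exists2 W, 0 <= W & forall x, box a b x -> `|f x| <= W.
Proof.
move=> cf; have cbox : compact (box a b).
  rewrite (_ : box a b = [set v : 'rV[R]_d | forall i, `[a i, b i]%classic (v ord0 i)]).
    by apply: (@rV_compact R d (fun i => `[a i, b i]%classic)) => i; exact: segment_compact.
  by apply/seteqP; split => v h i; have := h i; rewrite /= in_itv.
have [M [_ hM]] := compact_bounded (continuous_compact cf cbox).
exists (`|M| + 1); first by rewrite addr_ge0.
move=> x bx; apply: hM; last by exists x.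
by rewrite (le_lt_trans (ler_norm M))// ltrDl.
Qed.

Unset Implicit Arguments.
Set Strict Implicit.

Theorem theorem3p1 (R : realType) (sigma : R -> R) (alpha : R)
  (d : nat) (a b : 'I_d -> R) (f : 'rV[R]_d -> R) (nu : R) :
  sigmoidal sigma -> Sigma1 sigma -> Sigma2 sigma ->
  Sigma3 sigma alpha -> 1 < alpha ->
  (M_beta 1 (derive1 (phi_sigma sigma)) < +oo)%E ->
  (forall i, a i < b i) ->
  CI (box a b) f ->
  0 < nu < 1 ->
  (exists C : R, exists N : nat, forall n : nat, (N <= n)%N -> (0 < n)%N ->
     forall x, box a b x ->
       `|Fn sigma a b f n x - f x| <= C * powR n%:R (- nu)) ->
  Lip (box a b) nu f.
Proof.
move=> sg s1 s2 s3 alpha1 M1 ab cf nu01 [C [N hC]]; split=> //.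
have [K K0 hK] := Fn_lipschitz d sg s1 s2 s3 alpha1 M1.
have [W W0 hW] := box_bounded cf.
pose g (v : 'I_d -> R) := f (\row_i v i).
have boxE v : in_box a b v -> box a b (\row_i v i).
  by move=> bv i; rewrite mxE; exact: bv.
(* From [N0] on, the approximation rate holds and [n] exceeds every [1 / (b i - a i)], so each
   scaled side has length at least 1. *)
pose N0 := (N + 1 + \sum_i (Num.truncn (b i - a i)^-1).+1)%N.
have N00 : (0 < N0)%N by rewrite /N0; lia.
have hN0 n i : (N0 <= n)%N -> 1 <= n%:R * (b i - a i).
  move=> Nn; rewrite -ler_pdivrMr ?subr_gt0// div1r ltW//.
  rewrite (lt_le_trans (truncnS_gt _))// ler_nat (leq_trans _ Nn)//.
  by rewrite /N0 (bigD1 i)//= addnCA leq_addr.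
have [|n w delta Nn w0 delta0 osc|L L0 hL] :=
    @osc_le_bootstrap R d a b g K `|C| (W + W) nu N0 K0 (normr_ge0 C) nu01 N00 _
      (addr_ge0 W0 W0).
- move=> delta x y bx by_ _; rewrite (le_trans (ler_normB _ _))// lerD// hW//; exact: boxE.
- move=> x y bx by_ xy.
  have n0 : (0 < n)%N := leq_trans N00 Nn.
  have Nn' : (N <= n)%N by rewrite (leq_trans _ Nn)// /N0 -addnA leq_addr.
  have hE v : in_box a b v ->
      `|Fn sigma a b f n (\row_i v i) - g v| <= `|C| * n%:R `^ (- nu).
    move=> bv; rewrite (le_trans (hC n Nn' n0 _ (boxE _ bv)))//.
    by rewrite ler_wpM2r ?powR_ge0// ler_norm.
  have hF := hK a b f n n0 (fun i => hN0 n i Nn) w delta _ _ w0 delta0 osc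
    (boxE _ bx) (boxE _ by_).
  have {}hF := hF ltac:(by move=> i; rewrite !mxE; exact: xy).
  have hx := hE _ bx; have hy := hE _ by_.
  rewrite distrC in hx.
  (* Passing through the operator values at [x] and [y] costs two approximation errors and one
     Lipschitz term. *)
  have := ler_distD (Fn sigma a b f n (\row_i x i)) (g x) (g y).
  have := ler_distD (Fn sigma a b f n (\row_i y i)) (Fn sigma a b f n (\row_i x i)) (g y).
  lra.
exists L, N0%:R^-1; split; first by rewrite invr_gt0 ltr0n.
move=> delta hdelta; apply: ge_ereal_sup => _ [x [y [bx [by_ [xy ->]]]]].
rewrite lee_fin.
have rE (v : 'rV[R]_d) : \row_i v ord0 i = v by apply/rowP => i; rewrite mxE.
have := hL delta hdelta (fun i => x ord0 i) (fun i => y ord0 i) bx by_.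
rewrite /g !rE; apply => i; apply: le_trans xy.
by have := coord_le_norm2 (x - y) i; rewrite !mxE.
Qed.
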